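(* Let $n\ge 4$ be an even integer. For $r \ge 1$ with $\mu(M_{n,r})>0$, let $p_n(r)$ be the probability that a random equilateral spatial $n$-gon, chosen from $M_{n,r}$ according to the normalized measure $\mu/\mu(M_{n,r})$, is knotted. Then the knotting probability is decreasing (in the weak sense) when the confinement diameter is close to $n/2$: there exists $\epsilon>0$ such that $p_n(r')\le p_n(r)$ whenever $n/2-\epsilon< r\le r'\le n/2$.
   Context: Let $\mathbb{S}^2_1\subset\mathbb{R}^3$ be the unit sphere. The moduli space of equilateral spatial $n$-gons is $M_n = \{(e_1,\dots,e_n)\in(\mathbb{S}^2_1)^n : \sum_{i=1}^n e_i=0\}/SO(3)$; the vertices are $v_1,\dots,v_n$ with $e_i=v_{i+1}-v_i$ (indices modulo $n$). The diameter of a polygon is the maximum distance between two of its vertices, and $M_{n,r}$ is the set of elements of $M_n$ of diameter at most $r$, i.e. $\|\sum_{i=j}^k e_i\|\le r$ for all $1\le j\le k\le n$. Off a null set, $M_n$ has action-angle coordinates $(\ell_i,\theta_i)_{i=3}^{n-1}$, where $\ell_i=d(v_1,v_i)$ and $\theta_i\in[0,2\pi)$ is the angle of rotation about the line $\overline{v_1v_i}$ between the triangles $v_1v_{i-1}v_i$ and $v_1v_iv_{i+1}$. The $\ell_i$ range over the values satisfying the triangle inequalities of the triangles with side lengths $\ell_i,\ell_{i+1},1$ for $2\le i\le n-1$, where $\ell_2=\ell_n=1$. The symplectic volume measure is $d\mu=\prod_{i=3}^{n-1}d\ell_i\,d\theta_i$. A polygon is knotted if it is an embedded closed curve in $\mathbb{R}^3$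 that is a nontrivial knot (non-embedded polygons form a set of measure zero). *)

(* Defs.v *)
From HB Require Import structures.
From mathcomp Require Import all_boot all_order all_algebra.
From mathcomp Require Import all_classical all_reals all_analysis.

Set Implicit Arguments.
Unset Strict Implicit.
Unset Printing Implicit Defensive.

Import Order.TTheory GRing.Theory Num.Theory.
Import numFieldNormedType.Exports.

Local Open Scope classical_set_scope.
Local Open Scope ring_scope.

Section LebesgueTuple.
Context {R : realType}.
Local Notation RT := (measurableTypeR R).

Definition tuple_cons m (p : RT * m.-tuple RT) : m.+1.-tuple RT :=
  [tuple of p.1 :: p.2].

Lemma measurable_tuple_cons m : measurable_fun setT (@tuple_cons m).
Proof. exact: (measurable_cons measurable_fst measurable_snd). Qed.

Section ConsMeasure.
Variables (m : nat) (nu : {sigma_finite_measure set (m.-tuple RT) -> \bar R}).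

Definition cons_measure : set (m.+1.-tuple RT) -> \bar R :=
  pushforward (@lebesgue_measure R \x nu)%E (@tuple_cons m).

Let cons_measure0 : cons_measure set0 = 0%E.
Proof. by rewrite /cons_measure /pushforward preimage_set0 measure0. Qed.

Let cons_measure_ge0 A : (0 <= cons_measure A)%E.
Proof. exact: integral_ge0. Qed.

Let cons_measure_sigma_additive : semi_sigma_additive cons_measure.
Proof.
move=> F mF tF mUF; rewrite /cons_measure /pushforward preimage_bigcup.
have mcons A : measurable A -> measurable (@tuple_cons m @^-1` A).
  by move=> mA; rewrite -[X in measurable X]setTI; exact: measurable_tuple_cons.
apply: measure_semi_sigma_additive.
- by move=> n; exact: mcons.
- apply/trivIsetP => /= i j _ _ ij; rewrite -preimage_setI.
  by move/trivIsetP : tF => /(_ _ _ _ _ ij) ->//; rewrite preimage_set0.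
- by rewrite -preimage_bigcup; exact: mcons.
Qed.

HB.instance Definition _ := isMeasure.Build _ _ _ cons_measure
  cons_measure0 cons_measure_ge0 cons_measure_sigma_additive.

Let cons_measure_sigma_finite : sigma_finite setT cons_measure.
Proof.
have /sigma_finiteP[F [TF ndF Foo]] := sigma_finiteT (@lebesgue_measure R).
have /sigma_finiteP[G [TG ndG Goo]] := sigma_finiteT nu.
pose uncons (x : m.+1.-tuple RT) : RT * m.-tuple RT :=
  (thead x, [tuple of behead x]).
have munc : measurable_fun setT uncons.
  apply/measurable_fun_pairP; split; first exact: (measurable_tnth ord0).
  exact: measurable_behead.
have unconsK : uncons \o @tuple_cons m = id.
  by apply/funext => -[a t]; congr pair; exact/val_inj.
exists (fun k => uncons @^-1` (F k `*` G k)).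
  rewrite -preimage_bigcup -[LHS](preimage_setT uncons); congr (_ @^-1` _).
  rewrite -setXTT TF TG predeqE => -[x y]; split.
    move=> [/= [k _ Fkx] [l _ Gly]]; exists (maxn k l) => //; split.
    - by move: x Fkx; exact/subsetPset/ndF/leq_maxl.
    - by move: y Gly; exact/subsetPset/ndG/leq_maxr.
  by move=> [k _ []/= ? ?]; split; exists k.
move=> k; have [mF Fk] := Foo k; have [mG Gk] := Goo k; split.
  by rewrite -[X in measurable X]setTI; apply: munc => //; exact: measurableX.
rewrite /cons_measure /pushforward -comp_preimage unconsK preimage_id.
by rewrite product_measure1E// lte_mul_pinfty// ge0_fin_numE.
Qed.

HB.instance Definition _ := Measure_isSigmaFinite.Build _ _ _ cons_measure
  cons_measure_sigma_finite.

End ConsMeasure.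

(* m-dimensional Lebesgue measure, as an iterated product; for m = 0 it is the
   unit mass at the empty tuple. *)
Fixpoint lebesgue_tuple (m : nat) :
    {sigma_finite_measure set (m.-tuple RT) -> \bar R} :=
  match m with
  | 0 => dirac [tuple]
  | m'.+1 => cons_measure (lebesgue_tuple m')
  end.

End LebesgueTuple.

Section Vectors.
Context {R : realType}.
Implicit Types u v : 'rV[R]_3.

Definition dot u v : R := \sum_k u 0 k * v 0 k.

(* The norm [`|u|] of the library on 'rV[R]_3 is the sup norm, hence: *)
Definition enorm u : R := Num.sqrt (dot u u).

Definition normalize u : 'rV[R]_3 := (enorm u)^-1 *: u.

(* Coordinate indices are added modulo 3. *)
Definition cross u v : 'rV[R]_3 :=
  \row_(k < 3) (u 0 (k + 1) * v 0 (k + 2%:R) - u 0 (k + 2%:R) * v 0 (k + 1)).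

(* Rotations act on row vectors on the right. *)
Definition SO3 : set 'M[R]_3 := [set g | g *m g^T = 1%:M /\ \det g = 1].

End Vectors.

Section Knots.
Context {R : realType}.

Definition homeomorphism (T : topologicalType) (f : T -> T) : Prop :=
  exists g : T -> T, [/\ continuous f, continuous g, cancel f g & cancel g f].

Definition ambient_isotopic (K L : set 'rV[R]_3) : Prop :=
  exists H : R -> 'rV[R]_3 -> 'rV[R]_3,
    [/\ {within `[0, 1]%classic `*` setT,
          continuous (fun p : R * 'rV[R]_3 => H p.1 p.2)},
        forall t, t \in `[0, 1] -> homeomorphism (H t),
        H 0 =1 id
      & H 1 @` K = L].

Definition round_circle : set 'rV[R]_3 :=
  [set x | x 0 0 ^+ 2 + x 0 1 ^+ 2 = 1 /\ x 0 2%:R = 0].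

Definition unknot (K : set 'rV[R]_3) : Prop := ambient_isotopic K round_circle.

End Knots.

Section Polygons.
Context {R : realType} (n : nat).

(* A polygon is given by its edge vectors; with i : 'I_n counted from 0, [e i]
   is e_(i+1). *)
Definition polygon := 'I_n -> 'rV[R]_3.

Implicit Types e : polygon.

Definition equilateral e : Prop :=
  (forall i, enorm (e i) = 1) /\ \sum_i e i = 0.

(* [vtx e k] is v_(k+1); the translation is normalized by v_1 = 0. *)
Definition vtx e (k : nat) : 'rV[R]_3 := \sum_(i < n | (i < k)%N) e i.

Definition diameter e : R :=
  \big[Num.max/0]_(j < n) \big[Num.max/0]_(k < n) enorm (vtx e k - vtx e j).

Definition edge_point e (i : 'I_n) (s : R) : 'rV[R]_3 := vtx e i + s *: e i.

Definition closed_curve e : set 'rV[R]_3 :=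
  [set x | exists i s, s \in `[0, 1] /\ x = edge_point e i s].

Definition embedded e : Prop :=
  forall i j s t, s \in `[0, 1[ -> t \in `[0, 1[ ->
    edge_point e i s = edge_point e j t -> i = j /\ s = t.

Definition knotted e : Prop := embedded e /\ ~ unknot (closed_curve e).

Definition orbit e : set polygon :=
  [set e' | exists2 g, SO3 g & e' = (fun i => e i *m g)].

(* Elements of the moduli space M_n = {closed equilateral n-gons} / SO(3). *)
Definition moduli : set (set polygon) := [set orbit e | e in equilateral].

Definition moduli_le (r : R) : set (set polygon) :=
  [set orbit e | e in [set e | equilateral e /\ diameter e <= r]].

Definition moduli_knotted : set (set polygon) :=
  [set orbit e | e in [set e | equilateral e /\ knotted e]].

(* Oriented normal of the triangle v_1 v_(k+1) v_(k+2) of the fan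
   triangulation based at v_1 = 0. *)
Definition normal e (k : nat) : 'rV[R]_3 := cross (vtx e k) (vtx e k.+1).

Definition nondegenerate e : Prop :=
  forall k, (0 < k)%N -> (k.+1 < n)%N -> normal e k != 0.

Local Notation coord := ((n - 3).-tuple (measurableTypeR R)).

(* [x.1] lists l_3, ..., l_(n-1) and [x.2] lists theta_3, ..., theta_(n-1), so
   that index j stands for j + 3 and v_(j+3) is [vtx e j.+2]. The rotation of
   angle theta_i about the oriented line v_1 v_i carries the oriented normal of
   v_1 v_(i-1) v_i to that of v_1 v_i v_(i+1). *)
Definition action_angle e (x : coord * coord) : Prop :=
  forall j : 'I_(n - 3),
    let l : R := tnth x.1 j in
    let theta : R := tnth x.2 j in
    let N := normalize (normal e j.+1) in
    [/\ l = enorm (vtx e j.+2 - vtx e 0),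
        0 <= theta < 2 * pi
      & normalize (normal e j.+2) =
          cos theta *: N + sin theta *: cross (normalize (vtx e j.+2)) N].

(* The image of A under the chart. No constraint on the l_i has to be added:
   the triangle inequalities hold for the coordinates of any polygon. *)
Definition chart_image (A : set (set polygon)) : set (coord * coord) :=
  [set x | exists e, [/\ equilateral e, nondegenerate e, A (orbit e)
                       & action_angle e x]].

(* The symplectic volume \prod_i dl_i dtheta_i. *)
Definition mu (A : set (set polygon)) : \bar R :=
  (lebesgue_tuple (n - 3) \x lebesgue_tuple (n - 3))%E (chart_image A).

End Polygons.

(* Meaningful when 0 < mu (moduli_le r); mu is finite, since the l_i and theta_i
   are bounded. *)
Definition knotting_probability (R : realType) (n : nat) (r : R) : R :=
  fine (mu (@moduli_knotted R n `&` moduli_le r)) / fine (mu (@moduli_le R n r)).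

(* Main.v *)
Require Import Defs.
From mathcomp Require Import all_boot all_order all_algebra.
From mathcomp Require Import all_classical all_reals all_analysis.
From mathcomp Require Import ring lra zify.

(* An equilateral [n]-gon of diameter greater than [n/2 - 1] is never knotted: two
   vertices at such a distance are opposite, and both arcs joining them, made of
   [n/2] unit edges each, are strictly monotone in the direction of the diameter. The
   curve is therefore the union of the graphs of two functions of the height, and
   height-preserving homeomorphisms translate the midpoint of the two strands to the
   axis, unwind their difference to a fixed direction and adjust its length, which
   leaves the boundary of a planar square. Hence, for [r > n/2 - 1], the numerator of
   [p_n(r)] does not depend on [r], while its denominator is nondecreasing. *)

Set Implicit Arguments.
Unset Strict Implicit.
Unset Printing Implicit Defensive.

Import Order.TTheory GRing.Theory Num.Theory.
Import numFieldNormedType.Exports.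

Local Open Scope classical_set_scope.
Local Open Scope ring_scope.

(** * Isotopies to the identity *)

Section Continuity.
Context {R : realType} {T : topologicalType}.
Local Notation V := 'rV[R]_3.
Implicit Types f g h : T -> R.

Lemma continuous_add f g : continuous f -> continuous g ->
  continuous (fun x => f x + g x).
Proof. by move=> cf cg x; apply: cvgD; [exact: cf | exact: cg]. Qed.

Lemma continuous_opp f : continuous f -> continuous (fun x => - f x).
Proof. by move=> cf x; apply: cvgN; exact: cf. Qed.

Lemma continuous_mul f g : continuous f -> continuous g ->
  continuous (fun x => f x * g x).
Proof. by move=> cf cg x; apply: cvgM; [exact: cf | exact: cg]. Qed.

Lemma continuous_inv f : (forall x, f x != 0) -> continuous f ->
  continuous (fun x => (f x)^-1).
Proof. by move=> f0 cf x; apply: cvgV => //; exact: cf. Qed.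

Lemma continuous_cst (c : R) : continuous (fun _ : T => c).
Proof. by move=> x; exact: cvg_cst. Qed.

Lemma continuous_app (a : R -> R) f : continuous a -> continuous f ->
  continuous (fun x => a (f x)).
Proof. by move=> ca cf x; apply: continuous_comp; [exact: cf | exact: ca]. Qed.

Lemma continuous_coord (f : T -> V) k : continuous f ->
  continuous (fun x => f x 0 k).
Proof.
move=> cf x.
exact: (@continuous_comp _ _ _ f (fun v : V => v 0 k) x (cf x)
  (@coord_continuous _ _ _ _ _ _)).
Qed.

Definition vec3 (a b c : R) : V := \row_k nth 0 [:: a; b; c] k.

Lemma vec3E a b c :
  (vec3 a b c 0 0 = a) * (vec3 a b c 0 1 = b) * (vec3 a b c 0 2%:R = c).
Proof. by rewrite !mxE. Qed.

Lemma rV3P (u v : V) :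
  u 0 0 = v 0 0 -> u 0 1 = v 0 1 -> u 0 2%:R = v 0 2%:R -> u = v.
Proof.
move=> e0 e1 e2; apply/rowP => -[[|[|[|//]]] k3].
- by have -> : Ordinal k3 = 0 by exact/val_inj.
- by have -> : Ordinal k3 = 1 by exact/val_inj.
- by have -> : Ordinal k3 = 2%:R by exact/val_inj.
Qed.

Lemma continuous_vec3 f g h :
  continuous f -> continuous g -> continuous h ->
  continuous (fun x => vec3 (f x) (g x) (h x)).
Proof.
move=> cf cg ch.
have -> : (fun x => vec3 (f x) (g x) (h x)) =
    (fun x => f x *: vec3 1 0 0 + g x *: vec3 0 1 0 + h x *: vec3 0 0 1).
  apply/funext => x; apply: rV3P; rewrite ?mxE /=; ring.
move=> x; apply: cvgD; [apply: cvgD|]; apply: cvgZr_tmp.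
- exact: cf.
- exact: cg.
- exact: ch.
Qed.

End Continuity.

(** Syntax-directed continuity. Functions that are not built from the listed operations must have
    their continuity in the context; nonvanishing of inverted terms is left as a goal. *)
Ltac cont := lazymatch goal with
  | H : continuous ?f |- continuous ?f => exact: H
  | |- continuous ?F => lazymatch F with
    | fun x => vec3 (@?f x) (@?g x) (@?h x) =>
        apply: (@continuous_vec3 _ _ f g h); cont
    | fun x => @GRing.add _ (@?f x) (@?g x) =>
        apply: (@continuous_add _ _ f g); cont
    | fun x => @GRing.opp _ (@?f x) => apply: (@continuous_opp _ _ f); cont
    | fun x => @GRing.mul _ (@?f x) (@?g x) =>
        apply: (@continuous_mul _ _ f g); cont
    | fun x => @GRing.inv _ (@?f x) =>
        apply: (@continuous_inv _ _ f); [idtac | cont]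
    | fun x => @GRing.exp _ (@?f x) 2 =>
        apply: (@continuous_mul _ _ f f); cont
    | fun x => fun_of_matrix (@?f x) _ ?k =>
        apply: (@continuous_coord _ _ f k); cont
    | fun=> ?c => exact: continuous_cst
    | fun x => x => by move=> ?; exact: cvg_id
    | fun x => x.1 => by move=> ?; exact: cvg_fst
    | fun x => x.2 => by move=> ?; exact: cvg_snd
    | fun x => ?f (@?g x) => apply: (@continuous_app _ _ f g); cont
    | _ => idtac
    end
  | |- _ => idtac
  end.

Section Isotopies.
Context {R : realType}.
Local Notation V := 'rV[R]_3.

(** Joint continuity is required for all real times, which is stronger than in [ambient_isotopic]
    and keeps subspace topologies out of compositions. *)
Definition isotopic_id (f : V -> V) : Prop := exists H : R -> V -> V,
  [/\ continuous (fun p : R * V => H p.1 p.2),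
      forall t, t \in `[0, 1] -> homeomorphism (H t),
      H 0 =1 id & H 1 =1 f].

Lemma isotopic_id_comp (f g : V -> V) :
  isotopic_id f -> isotopic_id g -> isotopic_id (g \o f).
Proof.
move=> [F [cF hF F0 F1]] [G [cG hG G0 G1]].
exists (fun t => G t \o F t); split.
- move=> p; apply: (continuous2_cvg _ (cG (p.1, F p.1 p.2))); last exact: cF.
  exact: cvg_fst.
- move=> t t01; have [F' [cFt cF' FK F'K]] := hF t t01.
  have [G' [cGt cG' GK G'K]] := hG t t01.
  exists (F' \o G'); split.
  + by move=> x; apply: continuous_comp; [exact: cFt | exact: cGt].
  + by move=> x; apply: continuous_comp; [exact: cG' | exact: cF'].
  + exact: can_comp.
  + exact: can_comp.
- by move=> x /=; rewrite F0 G0.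
- by move=> x /=; rewrite F1 G1.
Qed.

Lemma isotopic_id_image (f : V -> V) (K : set V) :
  isotopic_id f -> ambient_isotopic K (f @` K).
Proof.
move=> [H [cH hH H0 H1]]; exists H; split => //.
- exact: continuous_subspaceT.
- by congr (_ @` _); apply/funext => x; exact: H1.
Qed.

(* The last two coordinates, read as a complex number, are multiplied by [a + i b]. *)
Definition twist (a b : R -> R) (x : V) : V :=
  vec3 (x 0 0) (a (x 0 0) * x 0 1 - b (x 0 0) * x 0 2%:R)
    (a (x 0 0) * x 0 2%:R + b (x 0 0) * x 0 1).

Lemma twist_comp (a b c d : R -> R) : twist a b \o twist c d =
  twist (fun h => a h * c h - b h * d h) (fun h => a h * d h + b h * c h).
Proof.
by apply/funext => x; apply: rV3P; rewrite /= /twist !vec3E //; ring.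
Qed.

Lemma continuous_twist (a b : R -> R) : continuous a -> continuous b ->
  continuous (twist a b).
Proof. by move=> ca cb; rewrite /twist; cont. Qed.

(* The segment from [1] to [a + i b] avoids [0] off the negative real axis. *)
Lemma isotopic_id_twist_slit (a b : R -> R) : continuous a -> continuous b ->
  (forall h, 0 < a h \/ b h != 0) -> isotopic_id (twist a b).
Proof.
move=> ca cb ab0.
pose A t h := 1 - t + t * a h; pose B t h := t * b h.
exists (fun t => twist (A t) (B t)); split.
- by rewrite /twist /A /B; cont.
- move=> t; rewrite in_itv /= => /andP[t0 t1].
  have cA : continuous (A t) by rewrite /A; cont.
  have cB : continuous (B t) by rewrite /B; cont.
  have N0 h : A t h ^+ 2 + B t h ^+ 2 != 0.
    apply/eqP => /eqP; rewrite paddr_eq0 ?sqr_ge0 // !sqrf_eq0 => /andP[].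
    rewrite /A /B mulf_eq0 => /eqP At0 /orP[/eqP t_0|/eqP bh0].
      by move: At0; rewrite t_0; lra.
    case: (ab0 h) => [ah|]; last by rewrite bh0 eqxx.
    move: t0; rewrite le_eqVlt => /orP[/eqP t_0|t_gt0].
      by move: At0; rewrite -t_0; lra.
    by have := mulr_gt0 t_gt0 ah; lra.
  pose N h := (A t h ^+ 2 + B t h ^+ 2)^-1.
  have cN : continuous N by apply: continuous_inv => //; rewrite /A /B; cont.
  (* The complex inverse: the conjugate divided by the squared modulus. *)
  exists (twist (fun h => A t h * N h) (fun h => - B t h * N h)); split.
  + exact: continuous_twist.
  + by apply: continuous_twist; cont.
  + move=> x; rewrite -[LHS]/((twist _ _ \o twist _ _) x) twist_comp.
    by apply: rV3P; rewrite !vec3E // /N; field; exact: N0.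
  + move=> x; rewrite -[LHS]/((twist _ _ \o twist _ _) x) twist_comp.
    by apply: rV3P; rewrite !vec3E // /N; field; exact: N0.
- by move=> x; apply: rV3P; rewrite !vec3E // /A /B; ring.
- by move=> x; apply: rV3P; rewrite !vec3E // /A /B; ring.
Qed.

(** The starting point of the chain of twists in [isotopic_id_twist]. Only negative reals fall
    outside the slit plane. *)
Lemma isotopic_id_twist_cst (p q : R) : p ^+ 2 + q ^+ 2 != 0 ->
  isotopic_id (twist (fun=> p) (fun=> q)).
Proof.
move=> pq0; have [p0|p0] := ltP 0 p.
  by apply: isotopic_id_twist_slit => [||h]; cont; left.
have [q0|q0] := eqVneq q 0; last first.
  by apply: isotopic_id_twist_slit => [||h]; cont; right.
have pN0 : p != 0.
  by apply: contra_neq pq0 => ->; rewrite q0; ring.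
(* A negative real [p] is the product of the two nonreal numbers [i] and [- i p]. *)
have -> : twist (fun=> p) (fun=> q) =
    twist (fun=> 0) (fun=> 1) \o twist (fun=> 0) (fun=> - p).
  by rewrite twist_comp q0; congr twist; apply/funext => h; ring.
apply: isotopic_id_comp; apply: isotopic_id_twist_slit => [||h]; cont; right.
- by rewrite oppr_eq0.
- exact: oner_neq0.
Qed.

End Isotopies.

(** * Twists along a path in the punctured plane, translations and shears *)

Section FiberwiseIsotopies.
Context {R : realType}.
Local Notation V := 'rV[R]_3.

(** Apply the local step at the supremum of the points of [[a, b]] where [P] holds: it carries [P]
    from a point just below the supremum to points above it, unless [b] is reached first. *)
Lemma chain_induction (P : R -> Prop) (a b : R) : a <= b -> P a ->
  (forall c, a <= c <= b -> exists2 d, 0 < d & forall x y,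
     a <= x -> x <= y -> y <= b -> `|x - c| < d -> `|y - c| < d ->
     P x -> P y) ->
  P b.
Proof.
move=> ab Pa step.
pose S := [set x | a <= x <= b /\ P x].
have Sa : S a by split => //; rewrite lexx.
have supS : has_sup S.
  by split; [exists a | exists b => x [/andP[_ xb] _]].
have aS : a <= sup S by apply: ub_le_sup => //; case: supS.
have Sb : sup S <= b by apply: ge_sup => [|x [/andP[_ xb] _]//]; exists a.
have [d d0 dP] := step (sup S) (introT andP (conj aS Sb)).
have [x [/andP[ax xb] Px] xS] := sup_adherent d0 supS.
have xS' : x <= sup S.
  by apply: ub_le_sup => //; [case: supS | split => //; rewrite ax xb].
have Py y : x <= y -> y <= b -> `|y - sup S| < d -> P y.
  by move=> xy yb yd; apply: (dP x y) => //; rewrite distrC ger0_norm; lra.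
have [SB|Sltb] := leP b (sup S).
  by apply: Py => //; rewrite ger0_norm; lra.
have [bd|db] := ltP b (sup S + d).
  by apply: Py => //; rewrite ger0_norm; lra.
have : S (sup S + d / 2).
  split; first by apply/andP; split; lra.
  by apply: Py; rewrite ?ger0_norm; lra.
by move=> /(ub_le_sup (proj2 supS)); lra.
Qed.

Lemma continuous_minr (f : R -> R) c : continuous f ->
  continuous (fun x => f (Num.min x c)).
Proof.
move=> cf; apply: continuous_app => // x.
by apply: (@continuous_min R _ id (cst c)) => //; exact: cvg_cst.
Qed.

Lemma continuous_maxr (f : R -> R) c : continuous f ->
  continuous (fun x => f (Num.max x c)).
Proof.
move=> cf; apply: continuous_app => // x.
by apply: (@continuous_max R _ id (cst c)) => //; exact: cvg_cst.
Qed.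

(* Cutting the path [(a, b)] of the punctured plane into short pieces, on which the
   argument varies by less than a right angle, avoids a continuous logarithm. *)
Lemma isotopic_id_twist (a b : R -> R) (h0 h1 : R) : h0 <= h1 ->
  continuous a -> continuous b -> (forall h, a h ^+ 2 + b h ^+ 2 != 0) ->
  (forall h, h <= h0 -> a h = a h0 /\ b h = b h0) ->
  (forall h, h1 <= h -> a h = a h1 /\ b h = b h1) ->
  isotopic_id (twist a b).
Proof.
move=> h01 ca cb ab0 ab_l ab_r.
(* The path is frozen from height [c] on: [P h0] concerns a constant twist, [P h1] the whole one. *)
pose P c := isotopic_id
  (twist (fun h => a (Num.min h c)) (fun h => b (Num.min h c))).
suff : P h1.
  rewrite /P.
  have -> : (fun h => a (Num.min h h1)) = a.
    by apply/funext => h; case: leP => // /ltW /ab_r[].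
  by have -> : (fun h => b (Num.min h h1)) = b;
    [apply/funext => h; case: leP => // /ltW /ab_r[] | ].
apply: (chain_induction h01) => [|c _].
  rewrite /P.
  have -> : (fun h => a (Num.min h h0)) = fun=> a h0.
    by apply/funext => h; case: leP => // /ab_l[].
  have -> : (fun h => b (Num.min h h0)) = fun=> b h0.
    by apply/funext => h; case: leP => // /ab_l[].
  exact: isotopic_id_twist_cst.
(* With [z = a + i b], this is the real part of [z p.1] times the conjugate of [z p.2]. Where it is
   positive, the quotient of the two values lies in the right half-plane. *)
pose g (p : R * R) := a p.1 * a p.2 + b p.1 * b p.2.
have cg : continuous g by rewrite /g; cont.
have g0 : 0 < g (c, c) by rewrite /g /= -!expr2 lt_def ab0 addr_ge0 ?sqr_ge0.
have : \forall p \near ((c, c) : R * R), 0 < g p.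
  exact: (cvgr_gt _ (cg (c, c)) _ g0).
move=> /nbhs_ballP[d /= d0 gd]; exists d => // x y h0x xy yh1 xc yc Px.
pose N := (a x ^+ 2 + b x ^+ 2)^-1.
have N0 : 0 < N by rewrite invr_gt0 lt_def ab0 addr_ge0 ?sqr_ge0.
(* [m] clamps to [[x, y]], and [a' + i b'] is the quotient [z (m h) / z x], the factor that turns
   the path frozen at [x] into the one frozen at [y]. *)
pose m h := Num.max (Num.min h y) x.
pose a' h := (a (m h) * a x + b (m h) * b x) * N.
pose b' h := (b (m h) * a x - a (m h) * b x) * N.
have cmn (f : R -> R) : continuous f -> continuous (fun h => f (m h)).
  move=> cf; have := @continuous_minr (fun h => f (Num.max h x)) y.
  by apply; exact: continuous_maxr.
rewrite /P; have -> : twist (fun h => a (Num.min h y)) (fun h => b (Num.min h y)) =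
    twist a' b' \o
    twist (fun h => a (Num.min h x)) (fun h => b (Num.min h x)).
  have E h : (m h = Num.min h y /\ Num.min h x = x) \/
             (m h = x /\ Num.min h x = Num.min h y).
    rewrite /m; have [hx|xh] := leP h x; last first.
      by left; case: (leP h y) => hy; case: leP => //; lra.
    right; have -> : Num.min h y = h by apply: min_l; lra.
    by split => //; exact: max_r.
  rewrite twist_comp; congr twist; apply/funext => h;
    rewrite /a' /b'; have [[-> ->]|[-> ->]] := E h; rewrite /N; field; exact: ab0.
apply: isotopic_id_comp => //; apply: isotopic_id_twist_slit => [||h].
- have := cmn _ ca; have := cmn _ cb; rewrite /a' => ? ?; cont.
- have := cmn _ ca; have := cmn _ cb; rewrite /b' => ? ?; cont.
left; apply: mulr_gt0 => //; apply: (gd (m h, x)); split => /=; last first.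
  by rewrite /ball /= distrC.
rewrite /ball /= distrC /m.
move: xc yc; rewrite !ltr_norml => /andP[? ?] /andP[? ?].
by case: (leP h y) => ?; [case: (leP h x) => ? | case: (leP y x) => ?];
  apply/andP; split; lra.
Qed.

Lemma isotopic_id_translate (a b : R -> R) : continuous a -> continuous b ->
  isotopic_id (fun x : V => vec3 (x 0 0) (x 0 1 + a (x 0 0)) (x 0 2%:R + b (x 0 0))).
Proof.
move=> ca cb.
exists (fun t (x : V) => vec3 (x 0 0) (x 0 1 + t * a (x 0 0))
                     (x 0 2%:R + t * b (x 0 0))); split.
- by cont.
- move=> t _; exists (fun x : V => vec3 (x 0 0) (x 0 1 - t * a (x 0 0))
                     (x 0 2%:R - t * b (x 0 0))); split.
  + by cont.
  + by cont.
  + by move=> x; apply: rV3P; rewrite !vec3E //; ring.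
  + by move=> x; apply: rV3P; rewrite !vec3E //; ring.
- by move=> x; apply: rV3P; rewrite !vec3E //; ring.
- by move=> x; apply: rV3P; rewrite !vec3E //; ring.
Qed.

(** This makes an affine function with positive first coefficient the new height. Positivity of [p]
    keeps the coefficient [1 - t + t * p] away from zero along the linear isotopy. *)
Lemma isotopic_id_shear (p q r s : R) : 0 < p -> isotopic_id
  (fun x : V => vec3 (p * x 0 0 + q * x 0 1 + r * x 0 2%:R + s) (x 0 1) (x 0 2%:R)).
Proof.
move=> p0.
exists (fun t (x : V) => vec3 ((1 - t + t * p) * x 0 0 +
  t * (q * x 0 1 + r * x 0 2%:R + s)) (x 0 1) (x 0 2%:R)); split.
- by cont.
- move=> t; rewrite in_itv /= => /andP[t0 t1].
  have P0 : 1 - t + t * p != 0.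
    rewrite gt_eqF //; move: t0; rewrite le_eqVlt => /orP[/eqP <-|t_gt0].
      by rewrite mul0r; lra.
    by have := mulr_gt0 t_gt0 p0; lra.
  exists (fun x : V => vec3 ((1 - t + t * p)^-1 * (x 0 0 -
    t * (q * x 0 1 + r * x 0 2%:R + s))) (x 0 1) (x 0 2%:R)); split.
  + by cont.
  + by cont.
  + by move=> x; apply: rV3P; rewrite !vec3E //; field.
  + by move=> x; apply: rV3P; rewrite !vec3E //; field.
- by move=> x; apply: rV3P; rewrite !vec3E //; ring.
- by move=> x; apply: rV3P; rewrite !vec3E //; ring.
Qed.

End FiberwiseIsotopies.

(** * Curves with two monotone strands *)

Section TwoStrands.
Context {R : realType}.
Local Notation V := 'rV[R]_3.

(* Applied to both coordinates, [sgsqrt] maps the square [`|x| + `|y| = 1] onto the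
   unit circle. *)
Definition sgsqrt (x : R) : R := Num.sqrt x - Num.sqrt (- x).

Lemma sgsqrt_ge0 x : 0 <= x -> sgsqrt x = Num.sqrt x.
Proof. by move=> x0; rewrite /sgsqrt (@ler0_sqrtr _ (- x)) ?subr0 ?oppr_le0. Qed.

Lemma sgsqrtN x : sgsqrt (- x) = - sgsqrt x.
Proof. by rewrite /sgsqrt opprK opprB. Qed.

Lemma sqr_sgsqrt x : sgsqrt x ^+ 2 = `|x|.
Proof.
have [x0|/ltW x0] := leP 0 x; first by rewrite sgsqrt_ge0 ?sqr_sqrtr ?ger0_norm.
rewrite -[x]opprK sgsqrtN sqrrN normrN sgsqrt_ge0 ?oppr_ge0 //.
by rewrite sqr_sqrtr ?ger0_norm ?oppr_ge0.
Qed.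

Lemma sgsqrtK x : sgsqrt (x * `|x|) = x.
Proof.
have [x0|/ltW x0] := leP 0 x.
  by rewrite ger0_norm // -expr2 sgsqrt_ge0 ?sqr_ge0 // sqrtr_sqr ger0_norm.
rewrite ler0_norm // mulrN -expr2 sgsqrtN sgsqrt_ge0 ?sqr_ge0 //.
by rewrite sqrtr_sqr ler0_norm // opprK.
Qed.

Lemma continuous_sgsqrt : continuous sgsqrt.
Proof. by rewrite /sgsqrt; have := @sqrt_continuous R => ?; cont. Qed.

Definition sgsqrt_path (t x : R) : R := (1 - t) * x + t * sgsqrt x.

(* The signed square of the root [s >= 0] of [(1 - t) * s ^+ 2 + t * s = `|y|]; the
   rationalized form of the quadratic formula makes sense at [t = 1], but not at
   [t = 0 = y]. *)
Definition sgsqrt_path_inv (t y : R) : R :=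
  4 * y * `|y| * (t + Num.sqrt (t ^+ 2 + 4 * (1 - t) * `|y|)) ^- 2.

Lemma sgsqrt_pathN t x : sgsqrt_path t (- x) = - sgsqrt_path t x.
Proof. by rewrite /sgsqrt_path sgsqrtN; ring. Qed.

Lemma sgsqrt_path_invN t y : sgsqrt_path_inv t (- y) = - sgsqrt_path_inv t y.
Proof. by rewrite /sgsqrt_path_inv normrN; ring. Qed.

(** By oddness it suffices to treat [x = s ^+ 2] with [s >= 0], where the radicand is the square of
    [t + 2 * (1 - t) * s]. *)
Lemma sgsqrt_pathK t : 0 < t <= 1 -> cancel (sgsqrt_path t) (sgsqrt_path_inv t).
Proof.
move=> /andP[t0 t1].
have pos x : 0 <= x -> sgsqrt_path_inv t (sgsqrt_path t x) = x.
  move=> x0; rewrite /sgsqrt_path_inv /sgsqrt_path sgsqrt_ge0 //.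
  rewrite -(sqr_sqrtr x0); set s := Num.sqrt x.
  have s0 : 0 <= s by exact: sqrtr_ge0.
  rewrite sqrtr_sqr (ger0_norm s0).
  have D0 : 0 < t + (1 - t) * s.
    by rewrite ltr_wpDr ?mulr_ge0 ?subr_ge0.
  have -> : (1 - t) * s ^+ 2 + t * s = s * (t + (1 - t) * s) by ring.
  rewrite ger0_norm; last by rewrite mulr_ge0 // ltW.
  have -> : t ^+ 2 + 4 * (1 - t) * (s * (t + (1 - t) * s)) =
      (t + 2 * (1 - t) * s) ^+ 2 by ring.
  rewrite sqrtr_sqr ger0_norm; last first.
    by rewrite addr_ge0 ?(ltW t0) ?mulr_ge0 ?subr_ge0.
  have -> : t + (t + 2 * (1 - t) * s) = 2 * (t + (1 - t) * s) by ring.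
  by field; rewrite gt_eqF.
move=> x; have [/pos//|/ltW x0] := leP 0 x.
by rewrite -[x]opprK sgsqrt_pathN sgsqrt_path_invN pos ?oppr_ge0.
Qed.

Lemma sgsqrt_path_invK t : 0 < t <= 1 ->
  cancel (sgsqrt_path_inv t) (sgsqrt_path t).
Proof.
move=> /andP[t0 t1].
have pos y : 0 <= y -> sgsqrt_path t (sgsqrt_path_inv t y) = y.
  move=> y0; rewrite /sgsqrt_path_inv (ger0_norm y0).
  have N0 : 0 <= t ^+ 2 + 4 * (1 - t) * y.
    by rewrite addr_ge0 ?sqr_ge0 // mulr_ge0 // mulr_ge0 // subr_ge0.
  have := sqr_sqrtr N0; have := sqrtr_ge0 (t ^+ 2 + 4 * (1 - t) * y).
  set r := Num.sqrt _ => r0 rE.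
  have D0 : 0 < t + r by lra.
  have -> : 4 * y * y * (t + r) ^- 2 = (2 * y / (t + r)) ^+ 2.
    by field; rewrite gt_eqF.
  rewrite /sgsqrt_path sgsqrt_ge0 ?sqr_ge0 // sqrtr_sqr ger0_norm; last first.
    by rewrite mulr_ge0 ?mulr_ge0 // invr_ge0 ltW.
  have -> : (1 - t) * (2 * y / (t + r)) ^+ 2 + t * (2 * y / (t + r)) =
      y * (t ^+ 2 + 4 * (1 - t) * y + t ^+ 2 + 2 * t * r) / (t + r) ^+ 2.
    by field; rewrite gt_eqF.
  by rewrite -rE; field; rewrite gt_eqF.
move=> y; have [/pos//|/ltW y0] := leP 0 y.
by rewrite -[y]opprK sgsqrt_path_invN sgsqrt_pathN pos ?oppr_ge0.
Qed.

(** This rounds the square off to the circle. *)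
Lemma isotopic_id_sgsqrt :
  isotopic_id (fun x : V => vec3 (sgsqrt (x 0 0)) (sgsqrt (x 0 1)) (x 0 2%:R)).
Proof.
have cs := continuous_sgsqrt.
exists (fun t (x : V) =>
  vec3 (sgsqrt_path t (x 0 0)) (sgsqrt_path t (x 0 1)) (x 0 2%:R)); split.
- by rewrite /sgsqrt_path; cont.
- move=> t; rewrite in_itv /= => /andP[].
  rewrite le_eqVlt => /orP[/eqP <- _|t0 t1].
    (* At [t = 0] the denominator of [sgsqrt_path_inv] vanishes at the origin, so the identity is
       treated apart. *)
    have -> : (fun x : V =>
        vec3 (sgsqrt_path 0 (x 0 0)) (sgsqrt_path 0 (x 0 1)) (x 0 2%:R)) = id.
      apply/funext => x; apply: rV3P; rewrite !vec3E // /sgsqrt_path; ring.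
    by exists id; split => // x; exact: cvg_id.
  have t01 : 0 < t <= 1 by rewrite t0.
  exists (fun x : V =>
    vec3 (sgsqrt_path_inv t (x 0 0)) (sgsqrt_path_inv t (x 0 1)) (x 0 2%:R)).
  split.
  + by rewrite /sgsqrt_path; cont.
  + have ci : continuous (sgsqrt_path_inv t).
      rewrite /sgsqrt_path_inv.
      have cn : continuous (fun x : R => `|x|) by exact: norm_continuous.
      have cr := @sqrt_continuous R.
      cont => y.
      by rewrite sqrf_eq0 gt_eqF // ltr_pwDl // sqrtr_ge0.
    by cont.
  + by move=> x; apply: rV3P; rewrite !vec3E // sgsqrt_pathK.
  + by move=> x; apply: rV3P; rewrite !vec3E // sgsqrt_path_invK.
- by move=> x; apply: rV3P; rewrite !vec3E // /sgsqrt_path; ring.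
- by move=> x; apply: rV3P; rewrite !vec3E // /sgsqrt_path; ring.
Qed.

(* The difference of the strands vanishes at the heights [-1] and [1]. Being linear
   near them, it still has a limit direction there, which allows the twist
   [(k1, k2)] of the proof to be extended by constants. *)
Lemma straighten_two_strands (alpha beta : R -> V) (e e' : V) (d : R) :
  continuous alpha -> continuous beta ->
  (forall h, -1 <= h <= 1 -> alpha h 0 0 = h /\ beta h 0 0 = h) ->
  (forall h, -1 < h < 1 -> alpha h != beta h) ->
  0 < d <= 1 ->
  (forall h, -1 <= h <= d - 1 -> alpha h - beta h = (h + 1) *: e) ->
  (forall h, 1 - d <= h <= 1 -> alpha h - beta h = (1 - h) *: e') ->
  exists2 f, isotopic_id f &
    f @` ([set alpha h | h in `[-1, 1]] `|` [set beta h | h in `[-1, 1]]) =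
    round_circle.
Proof.
move=> ca cb hgt ab /andP[d0 d1] lin_l lin_r.
(* [w] is the half-difference of the strands, [c] minus their midpoint, and [q] the half-width of
   the target square. With [m = w / q] frozen outside [[d - 1, 1 - d]], the twist [k1 + i k2] is the
   complex inverse of [m 1 + i m 2], so it sends [w] to the real number [q]. *)
pose w k (h : R) := (alpha h 0 k - beta h 0 k) / 2.
pose c k (h : R) := - ((alpha h 0 k + beta h 0 k) / 2).
pose cl (h : R) := Num.min (Num.max h (d - 1)) (1 - d).
pose q (h : R) := 1 - `|h|.
pose m k h := w k (cl h) / q (cl h).
pose N h := m 1 h ^+ 2 + m 2%:R h ^+ 2.
pose k1 h := m 1 h / N h; pose k2 h := - (m 2%:R h / N h).
have cl_itv h : d - 1 <= cl h <= 1 - d.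
  by rewrite /cl le_min le_max ge_min !lexx !orbT !andbT /=; lra.
have q_gt0 h : -1 < h < 1 -> 0 < q h.
  by rewrite /q subr_gt0 ltr_norml.
have qcl h : 0 < q (cl h).
  by apply: q_gt0; have := cl_itv h; lra.
have N_gt0 h : 0 < N h.
  have clh : -1 < cl h < 1 by have := cl_itv h; lra.
  rewrite /N lt_def addr_ge0 ?sqr_ge0 // andbT.
  apply: contraTneq (ab _ clh) => /eqP.
  rewrite paddr_eq0 ?sqr_ge0 // !sqrf_eq0 /m !mulf_eq0 !invr_eq0.
  rewrite (gt_eqF (qcl h)) !orbF !pnatr_eq0 !orbF !subr_eq0 negbK.
  move=> /andP[/eqP e1 /eqP e2]; apply/eqP; apply: rV3P => //.
  by have [|-> ->] := hgt (cl h); first lra.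
(* Near the ends [w] and [q] are both linear and vanish at the same height, so their ratio is
   constant there and freezing [m] loses nothing. *)
have wE k h : -1 <= h <= 1 -> w k h = q h * m k h.
  move=> h1; rewrite /m.
  have [hl|hl] := ltP h (d - 1).
    have -> : cl h = d - 1.
      by rewrite /cl max_r ?min_l //; lra.
    have lin h' : -1 <= h' <= d - 1 -> w k h' = (h' + 1) * e 0 k / 2.
      by move=> /lin_l /matrixP/(_ 0 k); rewrite !mxE /w => ->.
    rewrite !lin /q; [|lra|lra].
    by rewrite !ler0_norm; [field; lra|lra|lra].
  have [hr|hr] := ltP (1 - d) h.
    have -> : cl h = 1 - d.
      by rewrite /cl min_r // le_max; lra.
    have lin h' : 1 - d <= h' <= 1 -> w k h' = (1 - h') * e' 0 k / 2.
      by move=> /lin_r /matrixP/(_ 0 k); rewrite !mxE /w => ->.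
    rewrite !lin /q; [|lra|lra].
    by rewrite !ger0_norm; [field; lra|lra|lra].
  have -> : cl h = h.
    by rewrite /cl max_l // min_l.
  have qh : q h != 0 by rewrite gt_eqF // q_gt0 //; lra.
  by field.
have ccl (f : R -> R) : continuous f -> continuous (fun h => f (cl h)).
  move=> cf; have := @continuous_maxr _ (fun h => f (Num.min h (1 - d))) (d - 1).
  by apply; exact: continuous_minr.
have cm k : continuous (m k).
  have cn : continuous (fun x : R => `|x|) by exact: norm_continuous.
  apply: continuous_mul; first by apply: ccl; rewrite /w; cont.
  apply: continuous_inv => [h|]; first by rewrite gt_eqF.
  by apply: ccl; rewrite /q; cont.
have cN : continuous (fun h => (N h)^-1).
  apply: continuous_inv => [h|]; first by rewrite gt_eqF.
  by have := cm 1; have := cm 2%:R; rewrite /N => ? ?; cont.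
have itw : isotopic_id (twist k1 k2).
  apply: (@isotopic_id_twist _ k1 k2 (d - 1) (1 - d)); first lra.
  - by have := cm 1; rewrite /k1 => ?; cont.
  - by have := cm 2%:R; rewrite /k2 => ?; cont.
  - move=> h; have -> : k1 h ^+ 2 + k2 h ^+ 2 = (N h)^-1.
      have NE := erefl (N h); rewrite {2}/N in NE.
      have -> : k1 h ^+ 2 + k2 h ^+ 2 = (m 1 h ^+ 2 + m 2%:R h ^+ 2) * (N h)^-1 ^+ 2.
        by rewrite /k1 /k2; ring.
      by rewrite -NE; field; rewrite gt_eqF.
    by rewrite invr_eq0 gt_eqF.
  - move=> h hl; rewrite /k1 /k2 /N /m.
    suff -> : cl h = cl (d - 1) by [].
    by rewrite /cl max_r // max_r.
  - move=> h hr; rewrite /k1 /k2 /N /m.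
    suff -> : cl h = cl (1 - d) by [].
    by rewrite /cl !min_r // le_max; lra.
have cc k : continuous (c k) by rewrite /c; cont.
have itr := isotopic_id_translate (cc 1) (cc 2%:R).
have ist := isotopic_id_comp (isotopic_id_comp itr itw) isotopic_id_sgsqrt.
set f := _ \o _ in ist.
have fa h : -1 <= h <= 1 -> f (alpha h) = vec3 (sgsqrt h) (sgsqrt (q h)) 0.
  move=> h1; have [ah _] := hgt h h1.
  rewrite /f /twist /= !vec3E ah.
  have -> : alpha h 0 1 + c 1 h = w 1 h by rewrite /c /w; field.
  have -> : alpha h 0 2%:R + c 2%:R h = w 2%:R h by rewrite /c /w; field.
  rewrite !wE //; congr (vec3 _ (sgsqrt _) _).
    have -> : k1 h * (q h * m 1 h) - k2 h * (q h * m 2%:R h) = q h * (N h / N h).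
      by rewrite /k1 /k2 {3}/N; ring.
    by rewrite divff ?mulr1 // gt_eqF.
  by rewrite /k1 /k2; ring.
have fb h : -1 <= h <= 1 -> f (beta h) = vec3 (sgsqrt h) (- sgsqrt (q h)) 0.
  move=> h1; have [_ bh] := hgt h h1.
  rewrite -sgsqrtN /f /twist /= !vec3E bh.
  have -> : beta h 0 1 + c 1 h = - w 1 h by rewrite /c /w; field.
  have -> : beta h 0 2%:R + c 2%:R h = - w 2%:R h by rewrite /c /w; field.
  rewrite !wE //; congr (vec3 _ (sgsqrt _) _).
    have -> : k1 h * - (q h * m 1 h) - k2 h * - (q h * m 2%:R h) =
        - (q h * (N h / N h)).
      by rewrite /k1 /k2 {3}/N; ring.
    by rewrite divff ?mulr1 // gt_eqF.
  by rewrite /k1 /k2; ring.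
exists f => //.
have qh h : -1 <= h <= 1 -> sgsqrt h ^+ 2 + sgsqrt (q h) ^+ 2 = 1.
  by rewrite -ler_norml => h1; rewrite !sqr_sgsqrt (@ger0_norm _ (q h)) /q; lra.
apply/seteqP; split => [_ [x + <-]|x [x1 x2]].
- by case=> -[h]; rewrite /= in_itv /= => h1 <-; rewrite ?fa ?fb //;
    split; rewrite !vec3E ?sqrrN ?qh.
(* The preimage of [x 0 0] under [sgsqrt]; the sign of [x 0 1] then selects the strand. *)
- pose h := x 0 0 * `|x 0 0|.
  have hn : `|h| = x 0 0 ^+ 2 by rewrite normrM normr_id -expr2 real_normK ?num_real.
  have h1 : -1 <= h <= 1.
    by rewrite -ler_norml hn -x1 lerDl sqr_ge0.
  have qE : sgsqrt (q h) = `|x 0 1|.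
    have -> : q h = x 0 1 ^+ 2 by rewrite /q hn -x1; ring.
    by rewrite sgsqrt_ge0 ?sqr_ge0 // sqrtr_sqr.
  have [y0|/ltW y0] := leP 0 (x 0 1).
    exists (alpha h); first by left; exists h => //; rewrite /= in_itv.
    by rewrite fa // qE sgsqrtK ger0_norm //; apply: rV3P; rewrite !vec3E.
  exists (beta h); first by right; exists h => //; rewrite /= in_itv.
  by rewrite fb // qE sgsqrtK ler0_norm // opprK; apply: rV3P; rewrite !vec3E.
Qed.

End TwoStrands.

(** * Monotone polylines as graphs over the height *)

Section Polylines.
Context {R : realType}.
Local Notation V := 'rV[R]_3.

Lemma segment_coord (P : nat -> V) i s k :
  (P i + s *: (P i.+1 - P i)) 0 k = P i 0 k + s * (P i.+1 0 k - P i 0 k).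
Proof. by rewrite !mxE. Qed.

Lemma segment_end (P : nat -> V) i : P i + 1 *: (P i.+1 - P i) = P i.+1.
Proof. by rewrite scale1r addrC subrK. Qed.

Lemma polyline_le (P : nat -> V) m :
  (forall i, (i < m)%N -> P i 0 0 < P i.+1 0 0) ->
  forall i j, (i <= j)%N -> (j <= m)%N -> P i 0 0 <= P j 0 0.
Proof.
move=> incr i j; elim: j => [|j IH]; first by rewrite leqn0 => /eqP ->.
rewrite leq_eqVlt => /orP[/eqP ->//|]; rewrite ltnS => /IH{}IH jm.
by apply: (le_trans (IH (ltnW jm))); exact/ltW/incr.
Qed.

(** Induction on the number of edges. The old graph is frozen above its top vertex, and a multiple
    of the new edge, zero below that vertex, is added; continuity then needs no gluing. *)
Lemma polyline_graph (P : nat -> V) m :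
  (forall i, (i < m)%N -> P i 0 0 < P i.+1 0 0) ->
  exists alpha : R -> V, [/\ continuous alpha, alpha (P m 0 0) = P m &
    forall i s, (i < m)%N -> 0 <= s <= 1 ->
      alpha ((P i + s *: (P i.+1 - P i)) 0 0) = P i + s *: (P i.+1 - P i)].
Proof.
elim: m => [_|m IH incr].
  by exists (fun=> P 0%N); split => // x; exact: cvg_cst.
have [i im|alpha [ca am aE]] := IH; first by apply: incr; rewrite ltnS ltnW.
have hm := incr m (ltnSn m).
set hm0 := P m 0 0 in am hm *.
have D0 : P m.+1 0 0 - hm0 != 0 by rewrite subr_eq0 gt_eqF.
pose beta h := alpha (Num.min h hm0) +
  ((Num.max h hm0 - hm0) / (P m.+1 0 0 - hm0)) *: (P m.+1 - P m).
have betaE i s : (i < m.+1)%N -> 0 <= s <= 1 ->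
    beta ((P i + s *: (P i.+1 - P i)) 0 0) = P i + s *: (P i.+1 - P i).
  rewrite ltnS leq_eqVlt /beta => /orP[/eqP -> /andP[s0 s1]|im s01].
    rewrite segment_coord -/hm0.
    have ps : 0 <= s * (P m.+1 0 0 - hm0).
      by rewrite mulr_ge0 // subr_ge0 ltW.
    rewrite min_r ?lerDl // max_l ?lerDl // am; congr (_ + _ *: _).
    by field.
  have := aE i s im s01; set h := _ 0 0 => ah.
  have hle : h <= hm0.
    have /andP[s0 s1] := s01.
    have Pi : P i 0 0 <= P i.+1 0 0 by exact/ltW/incr/ltnW.
    have : P i.+1 0 0 <= hm0.
      apply: (polyline_le (m := m)) => // k km.
      by apply: incr; rewrite ltnS ltnW.
    apply: le_trans; rewrite /h segment_coord -lerBrDl.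
    by rewrite ler_piMl // subr_ge0.
  by rewrite min_l // max_r // subrr mul0r scale0r addr0.
exists beta; split => //.
- move=> h; apply: cvgD.
    apply: (@continuous_comp _ _ _ (fun h => Num.min h hm0) alpha); last exact: ca.
    by apply: (@continuous_min R _ id (cst hm0)) => //; exact: cvg_cst.
  apply: cvgZr_tmp; apply: cvgM; last exact: cvg_cst.
  apply: cvgB; last exact: cvg_cst.
  by apply: (@continuous_max R _ id (cst hm0)) => //; exact: cvg_cst.
- by have := betaE m 1 (ltnSn m); rewrite segment_end ler01 lexx; exact.
Qed.

Lemma polyline_param (P : nat -> V) m :
  (forall i, (i < m)%N -> P i 0 0 < P i.+1 0 0) ->
  forall h, P 0%N 0 0 <= h -> h < P m 0 0 -> exists i s,
    [/\ (i < m)%N, 0 <= s < 1 & h = (P i + s *: (P i.+1 - P i)) 0 0].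
Proof.
elim: m => [_ h h0|m IH incr h h0 hm].
  by move=> /(le_lt_trans h0); rewrite ltxx.
have [hlt|hge] := ltP h (P m 0 0).
  have [i im|i [s [im s01 ->]]] := IH _ h h0 hlt.
    by apply: incr; rewrite ltnS ltnW.
  by exists i, s; split => //; rewrite ltnS ltnW.
have D0 : 0 < P m.+1 0 0 - P m 0 0 by rewrite subr_gt0; exact: incr.
exists m, ((h - P m 0 0) / (P m.+1 0 0 - P m 0 0)); split => //.
  rewrite divr_ge0 ?(ltW D0) ?subr_ge0 //=.
  by rewrite ltr_pdivrMr // mul1r ltrD2r.
by rewrite segment_coord; field; rewrite gt_eqF.
Qed.

(** Reversing a strand replaces [s] by [1 - s], so the reversed strand needs parameters in the other
    half-open interval; a vertex is then read as the end of the preceding edge. *)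
Lemma polyline_param_up (P : nat -> V) m :
  (forall i, (i < m)%N -> P i 0 0 < P i.+1 0 0) ->
  forall h, P 0%N 0 0 < h -> h < P m 0 0 -> exists i s,
    [/\ (i < m)%N, 0 < s <= 1 & h = (P i + s *: (P i.+1 - P i)) 0 0].
Proof.
move=> incr h h0 hm; have [i [s [im /andP[s0 s1] hE]]] :=
  polyline_param incr (ltW h0) hm.
move: s0; rewrite le_eqVlt => /orP[/eqP s0|s0]; last first.
  by exists i, s; rewrite s0 (ltW s1).
move: hE; rewrite -s0 scale0r addr0 => hE.
case: i im hE => [|i] im hE; first by move: h0; rewrite hE ltxx.
by exists i, 1; rewrite segment_end ltr01 lexx (ltnW im).
Qed.

End Polylines.

(** * Closed polygons with one ascending and one descending arc *)

Section MonotonePolygons.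
Context {R : realType}.
Local Notation V := 'rV[R]_3.

Definition segment_point (P : nat -> V) i s := P i + s *: (P i.+1 - P i).

Definition polygonal_curve (P : nat -> V) k : set V :=
  [set x | exists i s, [/\ (i < k)%N, 0 <= s <= 1 & x = segment_point P i s]].

Definition simple_polygon (P : nat -> V) k := forall i j s t,
  (i < k)%N -> (j < k)%N -> 0 <= s < 1 -> 0 <= t < 1 ->
  segment_point P i s = segment_point P j t -> i = j.

Lemma graph_segment (P : nat -> V) m (alpha : R -> V) :
  (forall i, (i < m)%N -> P i 0 0 < P i.+1 0 0) ->
  (forall i s, (i < m)%N -> 0 <= s <= 1 ->
     alpha (segment_point P i s 0 0) = segment_point P i s) ->
  forall i h, (i < m)%N -> P i 0 0 <= h <= P i.+1 0 0 ->
  alpha h = segment_point P i ((h - P i 0 0) / (P i.+1 0 0 - P i 0 0)).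
Proof.
move=> incr aE i h im /andP[h0 h1].
have D0 : 0 < P i.+1 0 0 - P i 0 0 by rewrite subr_gt0 incr.
rewrite -aE //; last first.
  by rewrite divr_ge0 ?(ltW D0) ?subr_ge0 //= ler_pdivrMr // mul1r lerD2r.
by congr alpha; rewrite segment_coord; field; rewrite gt_eqF.
Qed.

Lemma segment_point_rev (P : nat -> V) k i s : (i < k)%N ->
  segment_point (fun j => P (k - j)%N) i s =
  segment_point P (k - i.+1)%N (1 - s).
Proof.
move=> ik; rewrite /segment_point subnSK // ; apply/rowP => l.
by rewrite !mxE; ring.
Qed.

Lemma graph_height (P : nat -> V) m (alpha : R -> V) :
  (forall i, (i < m)%N -> P i 0 0 < P i.+1 0 0) -> alpha (P m 0 0) = P m ->
  (forall i s, (i < m)%N -> 0 <= s <= 1 ->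
     alpha (segment_point P i s 0 0) = segment_point P i s) ->
  forall h, P 0%N 0 0 <= h <= P m 0 0 -> alpha h 0 0 = h.
Proof.
move=> incr am aE h /andP[h0]; rewrite le_eqVlt => /orP[/eqP ->|hm].
  by rewrite am.
have [i [s [im /andP[s0 s1] ->]]] := polyline_param incr h0 hm.
by rewrite -/(segment_point P i s) aE // s0 ltW.
Qed.

Lemma graph_image (P : nat -> V) m (alpha : R -> V) : (0 < m)%N ->
  (forall i, (i < m)%N -> P i 0 0 < P i.+1 0 0) -> alpha (P m 0 0) = P m ->
  (forall i s, (i < m)%N -> 0 <= s <= 1 ->
     alpha (segment_point P i s 0 0) = segment_point P i s) ->
  [set alpha h | h in `[P 0%N 0 0, P m 0 0]] = polygonal_curve P m.
Proof.
move=> m0 incr am aE; apply/seteqP; split=> [_ [h + <-]|x [i [s [im s01 ->]]]].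
  rewrite /= in_itv /= => /andP[h0]; rewrite le_eqVlt => /orP[/eqP ->|hm].
    rewrite am; exists m.-1, 1; rewrite /segment_point segment_end prednK //.
    by rewrite ler01 lexx.
  have [i [s [im /andP[s0 s1] ->]]] := polyline_param incr h0 hm.
  by exists i, s; rewrite s0 (ltW s1) -/(segment_point P i s) aE // s0 ltW.
exists (segment_point P i s 0 0); last exact: aE.
have ii := ltW (incr i im); have /andP[s0 s1] := s01.
rewrite /= in_itv /=; apply/andP; split.
  apply: (le_trans (polyline_le incr (leq0n i) (ltnW im))).
  by rewrite segment_coord lerDl mulr_ge0 // subr_ge0.
apply: le_trans (polyline_le incr im (leqnn m)).
by rewrite segment_coord -lerBrDl ler_piMl // subr_ge0.
Qed.

(** The two arcs are graphs over the height, disjoint strictly between the extreme vertices by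
    simplicity, so [straighten_two_strands] applies. *)
Lemma straighten_normalized_polygon (P : nat -> V) m : (0 < m)%N ->
  P 0%N 0 0 = -1 -> P m 0 0 = 1 -> P (m + m)%N = P 0%N ->
  (forall i, (i < m)%N -> P i 0 0 < P i.+1 0 0) ->
  (forall i, (m <= i < m + m)%N -> P i.+1 0 0 < P i 0 0) ->
  simple_polygon P (m + m) ->
  exists2 f, isotopic_id f & f @` polygonal_curve P (m + m) = round_circle.
Proof.
move=> m0 P0 Pm Pmm incr decr simpleP.
(* The descending strand, traversed upwards. *)
pose Q i := P (m + m - i)%N.
have Q0 : Q 0%N = P 0%N by rewrite /Q subn0.
have Qm : Q m = P m by rewrite /Q addnK.
have incrQ i : (i < m)%N -> Q i 0 0 < Q i.+1 0 0.
  move=> im; rewrite /Q -(@subnSK i); last by move: im; clear; lia.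
  by apply: decr; move: im; clear; lia.
have revQ i s : (i < m + m)%N ->
    segment_point Q i s = segment_point P (m + m - i.+1)%N (1 - s).
  exact: segment_point_rev.
have [alpha [ca am aE]] := polyline_graph incr.
have [beta [cb bm bE]] := polyline_graph incrQ.
(* Within height [d] of either extreme vertex, each strand stays on a single edge. *)
pose d := Num.min (Num.min 1 (Num.min (P 1%N 0 0 + 1) (Q 1%N 0 0 + 1)))
  (Num.min (1 - P m.-1 0 0) (1 - Q m.-1 0 0)).
have [P1 Q1] : -1 < P 1%N 0 0 /\ -1 < Q 1%N 0 0.
  by split; [rewrite -P0; exact: incr | rewrite -P0 -Q0; exact: incrQ].
have [Pm1 Qm1] : P m.-1 0 0 < 1 /\ Q m.-1 0 0 < 1.
  split.
    by have := incr m.-1; rewrite prednK // Pm; exact.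
  by have := incrQ m.-1; rewrite prednK // Qm Pm; exact.
have : 0 < d <= 1.
  by rewrite /d !lt_min !ge_min lexx; apply/andP; split; lra.
have : [&& d <= P 1%N 0 0 + 1, d <= Q 1%N 0 0 + 1,
    d <= 1 - P m.-1 0 0 & d <= 1 - Q m.-1 0 0].
  by rewrite /d !ge_min !lexx !orbT.
move=> /and4P[dP1 dQ1 dPm dQm] d01.
(* Differences of the edge vectors per unit height, at the bottom and at the top. *)
pose e := (P 1%N 0 0 + 1)^-1 *: (P 1%N - P 0%N) -
          (Q 1%N 0 0 + 1)^-1 *: (Q 1%N - Q 0%N).
pose e' := (1 - Q m.-1 0 0)^-1 *: (Q m - Q m.-1) -
           (1 - P m.-1 0 0)^-1 *: (P m - P m.-1).
have : polygonal_curve P (m + m) =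
    [set alpha h | h in `[-1, 1]] `|` [set beta h | h in `[-1, 1]].
  have := graph_image m0 incr am aE; rewrite P0 Pm => ->.
  have := graph_image m0 incrQ bm bE; rewrite Q0 P0 Qm Pm => ->.
  apply/seteqP; split=> [x [i [s [im s01 ->]]]|x [] [i [s [im s01 ->]]]].
  - have [lt_im|le_mi] := ltnP i m; first by left; exists i, s.
    right; exists (m + m - i.+1)%N, (1 - s).
    split; [by move: im le_mi; clear; lia | by move: s01; clear; lra |].
    rewrite revQ; last by move: im; clear; lia.
    by rewrite subKr; congr segment_point; move: im; clear; lia.
  - by exists i, s; split => //; move: im; clear; lia.
  - exists (m + m - i.+1)%N, (1 - s).
    split; [by move: im; clear; lia | by move: s01; clear; lra |].
    by rewrite revQ //; move: im; clear; lia.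
move=> ->; apply: (@straighten_two_strands _ alpha beta e e' d) => //.
- move=> h h1; split.
    by apply: (graph_height incr am aE); rewrite P0 Pm.
  by apply: (graph_height incrQ bm bE); rewrite Q0 P0 Qm Pm.
- move=> h /andP[h0 h1]; apply/eqP.
  have [||i [s [im /andP[s0 s1] hs]]] := @polyline_param _ P m incr h.
  + by rewrite P0 ltW.
  + by rewrite Pm.
  (* With [t] in []0, 1]], the parameter [1 - t] along [P] lies in [[0, 1[], as [simple_polygon]
     demands. A common point would then equate an edge index below [m] with one that is at least
     [m]. *)
  have [||j [t [jm /andP[t0 t1] ht]]] := @polyline_param_up _ Q m incrQ h.
  + by rewrite Q0 P0.
  + by rewrite Qm Pm.
  rewrite {1}hs aE ?s0 ?ltW // {1}ht bE ?t1 ?ltW //.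
  rewrite -/(segment_point P i s) -/(segment_point Q j t).
  rewrite revQ; last by move: jm; clear; lia.
  move=> eqP; have := simpleP i (m + m - j.+1)%N s (1 - t) _ _ _ _ eqP.
  have im2 : (i < m + m)%N by move: im; clear; lia.
  have jm2 : (m + m - j.+1 < m + m)%N by move: jm; clear; lia.
  have s01 : 0 <= s < 1 by rewrite s0.
  have t01 : 0 <= 1 - t < 1 by lra.
  by move=> /(_ im2 jm2 s01 t01); move: im jm; clear; lia.
- move=> h /andP[h0 h1].
  rewrite (graph_segment incr aE m0); last by rewrite P0 h0; lra.
  rewrite (graph_segment incrQ bE m0); last by rewrite Q0 P0 h0; lra.
  rewrite /segment_point Q0 P0 opprK /e Q0; apply/rowP => l; rewrite !mxE.
  by field; rewrite !gt_eqF //; lra.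
- move=> h /andP[h0 h1].
  have m1 : (m.-1 < m)%N by rewrite prednK.
  rewrite (graph_segment incr aE m1) prednK //; last by rewrite Pm h1; lra.
  rewrite (graph_segment incrQ bE m1) prednK //; last by rewrite Qm Pm h1; lra.
  rewrite /segment_point prednK // Qm Pm /e' Qm; apply/rowP => l; rewrite !mxE.
  by field; rewrite !gt_eqF //; lra.
Qed.

Lemma isotopic_id_inj (f : V -> V) : isotopic_id f -> injective f.
Proof.
move=> [H [_ hH _ H1]]; have [|g [_ _ Hg _]] := hH 1.
  by rewrite in_itv /= ler01 lexx.
by move=> x y; rewrite -!H1 => /(congr1 g); rewrite !Hg.
Qed.

Lemma dotE (u v : V) :
  dot u v = u 0 0 * v 0 0 + u 0 1 * v 0 1 + u 0 2%:R * v 0 2%:R.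
Proof.
rewrite /dot !big_ord_recl big_ord0 addr0 addrA.
by congr (_ * _ + _ * _ + _ * _); congr (_ _ _); exact/val_inj.
Qed.

(** A shear turns the affine function [c * dot u x + s] into the height; [c] and [s] are chosen to
    put [P 0] at height [-1] and [P m] at height [1]. *)
Lemma straighten_polygon (P : nat -> V) m (u : V) : (0 < m)%N -> 0 < u 0 0 ->
  P (m + m)%N = P 0%N ->
  (forall i, (i < m)%N -> 0 < dot u (P i.+1 - P i)) ->
  (forall i, (m <= i < m + m)%N -> dot u (P i.+1 - P i) < 0) ->
  simple_polygon P (m + m) ->
  exists2 f, isotopic_id f & f @` polygonal_curve P (m + m) = round_circle.
Proof.
move=> m0 u0 Pmm incr decr simpleP.
have dotB x y : dot u (x - y) = dot u x - dot u y.
  by rewrite !dotE !mxE; ring.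
pose D := dot u (P m) - dot u (P 0%N).
have D0 : 0 < D.
  rewrite subr_gt0.
  suff H k : (0 < k <= m)%N -> dot u (P 0%N) < dot u (P k).
    by apply: H; rewrite m0 leqnn.
  elim: k => // -[_ _|k IH /= km].
    by rewrite -subr_gt0 -dotB incr.
  apply: lt_trans (IH _) _; first by rewrite ltnS /= ltnW.
  by rewrite -subr_gt0 -dotB incr.
pose c := 2 / D.
have c0 : 0 < c by rewrite divr_gt0.
pose s := - (c * dot u (P 0%N)) - 1.
have isoF := @isotopic_id_shear _ (c * u 0 0) (c * u 0 1) (c * u 0 2%:R) s
  (mulr_gt0 c0 u0).
set F := (fun x : V => _) in isoF.
have F0 x : F x 0 0 = c * dot u x + s.
  by rewrite /F vec3E dotE; ring.
have F12 x k : k != 0 -> F x 0 k = x 0 k.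
  case: k => -[|[|[|//]]] k3 // _; rewrite /F mxE /=;
  by congr (x _ _); exact/val_inj.
have Fseg i t : F (segment_point P i t) = segment_point (F \o P) i t.
  apply/rowP => k; have [->|k0] := eqVneq k 0.
    by rewrite F0 segment_coord /= !F0 !dotE !segment_coord; ring.
  by rewrite F12 // !segment_coord /= !F12.
have [||||||g isog gE] := @straighten_normalized_polygon (F \o P) m m0.
- by rewrite /= F0 /s; ring.
- rewrite /= F0 /s /c.
  have -> : dot u (P m) = D + dot u (P 0%N) by rewrite /D subrK.
  by field; rewrite gt_eqF.
- by rewrite /= Pmm.
- move=> i im; rewrite /= !F0 ltrD2r ltr_pM2l // -subr_gt0 -dotB.
  exact: incr.
- move=> i im; rewrite /= !F0 ltrD2r ltr_pM2l // -subr_lt0 -dotB.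
  exact: decr.
- move=> i j a b im jm a01 b01; rewrite -!Fseg => /(isotopic_id_inj isoF).
  exact: simpleP.
exists (g \o F); first exact: isotopic_id_comp.
rewrite -image_comp -gE; congr (g @` _); apply/seteqP.
split=> [_ [_ [i [t [im t01 ->]]] <-]|_ [i [t [im t01 ->]]]].
  by exists i, t; rewrite Fseg.
by exists (segment_point P i t); [exists i, t | rewrite Fseg].
Qed.

End MonotonePolygons.

(** * Equilateral polygons of large diameter *)

Section WidePolygons.
Context {R : realType}.
Local Notation V := 'rV[R]_3.

Lemma dot_suml (u : V) k (F : nat -> V) :
  dot u (\sum_(i < k) F i) = \sum_(i < k) dot u (F i).
Proof.
apply: (big_morph (dot u)) => [x y|]; first by rewrite !dotE !mxE; ring.
by rewrite dotE !mxE; ring.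
Qed.

Lemma dot_ge0 (u : V) : 0 <= dot u u.
Proof. by apply: sumr_ge0 => k _; rewrite -expr2 sqr_ge0. Qed.

Lemma sqr_enorm (u : V) : enorm u ^+ 2 = dot u u.
Proof. by rewrite sqr_sqrtr ?dot_ge0. Qed.

Lemma dot_unit_le (u v : V) : enorm v = 1 -> dot u v <= enorm u.
Proof.
move=> v1; have vv : dot v v = 1 by rewrite -sqr_enorm v1 expr1n.
apply: le_trans (ler_norm _) _.
rewrite -(@ler_pXn2r _ 2) ?nnegrE ?sqrtr_ge0 // sqr_enorm real_normK ?num_real //.
rewrite -[leRHS]mulr1 -vv -subr_ge0.
(* Lagrange's identity. *)
have -> : dot u u * dot v v - dot u v ^+ 2 =
    (u 0 0 * v 0 1 - u 0 1 * v 0 0) ^+ 2 +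
    (u 0 1 * v 0 2%:R - u 0 2%:R * v 0 1) ^+ 2 +
    (u 0 2%:R * v 0 0 - u 0 0 * v 0 2%:R) ^+ 2 by rewrite !dotE; ring.
by rewrite !addr_ge0 ?sqr_ge0.
Qed.

Lemma coord0_unit (v : V) : enorm v = 1 -> -1 <= v 0 0 <= 1.
Proof.
move=> v1; have vv : dot v v = 1 by rewrite -sqr_enorm v1 expr1n.
rewrite -ler_norml -(@ler_pXn2r _ 2) ?nnegrE // expr1n real_normK ?num_real //.
by rewrite -vv dotE !expr2 -addrA lerDl addr_ge0 // -expr2 sqr_ge0.
Qed.

(* Each of the other [k] summands contributes at most [enorm u] to [dot u u]. *)
Lemma dot_unit_sum_ge (u : V) k (F : nat -> V) :
  (forall i, enorm (F i) = 1) -> u = \sum_(i < k.+1) F i ->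
  forall i, (i < k.+1)%N -> enorm u * (enorm u - k%:R) <= dot u (F i).
Proof.
move=> F1 uE i ik; have := dot_suml u k.+1 F; rewrite -uE -sqr_enorm.
rewrite (bigD1 (Ordinal ik)) //= => uu.
have : \sum_(j < k.+1 | j != Ordinal ik) dot u (F j) <= k%:R * enorm u.
  apply: (@le_trans _ _ (\sum_(j < k.+1 | j != Ordinal ik) enorm u)).
    by apply: ler_sum => j _; exact: dot_unit_le.
  by rewrite sumr_const mulr_natl cardC1 card_ord.
by move: uu; lra.
Qed.

Lemma unit_sum_enorm_le (u : V) k (F : nat -> V) :
  (forall i, enorm (F i) = 1) -> u = \sum_(i < k) F i -> enorm u <= k%:R.
Proof.
move=> F1 uE; have := dot_suml u k F; rewrite -uE -sqr_enorm => uu.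
have : enorm u ^+ 2 <= enorm u * k%:R.
  rewrite uu; apply: (@le_trans _ _ (\sum_(j < k) enorm u)).
    by apply: ler_sum => j _; exact: dot_unit_le.
  by rewrite sumr_const card_ord mulr_natr.
have [->|u0] := eqVneq (enorm u) 0; first by rewrite ler0n.
by rewrite expr2 ler_pM2l // lt_def u0 sqrtr_ge0.
Qed.

(** * Cyclic indexing of edges and vertices from an arbitrary start *)

Section CyclicIndices.
Context (n : nat) (n_gt0 : (0 < n)%N) (e : @polygon R n).

Definition cyc (i : nat) : 'I_n := Ordinal (ltn_pmod i n_gt0).

Definition cyc_vtx (i : nat) : V := vtx e (i %% n).

Lemma vtxS (i : 'I_n) : vtx e i.+1 = vtx e i + e i.
Proof.
rewrite /vtx (bigD1 i) //= addrC; congr (_ + _); apply: eq_bigl => j.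
by rewrite ltnS ltn_neqAle andbC.
Qed.

Hypothesis closed : \sum_i e i = 0.

Lemma cyc_vtxS i : cyc_vtx i.+1 = cyc_vtx i + e (cyc i).
Proof.
rewrite /cyc_vtx -(vtxS (cyc i)) /=.
have -> : (i.+1 %% n = (i %% n).+1 %% n)%N by rewrite -addn1 -modnDml addn1.
have := ltn_pmod i n_gt0; rewrite leq_eqVlt => /orP[/eqP ->|lt_in].
  (* At the wrap-around the next vertex is the first one, [0], which is the sum of all edges. *)
  rewrite modnn /vtx big_pred0 // -[LHS]closed.
  by apply: eq_bigl => j; rewrite ltn_ord.
by rewrite modn_small.
Qed.

Lemma cyc_vtxD i k : cyc_vtx (i + k) - cyc_vtx i = \sum_(l < k) e (cyc (i + l)).
Proof.
elim: k => [|k IH]; first by rewrite addn0 subrr big_ord0.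
by rewrite big_ord_recr /= -IH addnS cyc_vtxS addrAC.
Qed.

Lemma cyc_period i : cyc (i + n) = cyc i.
Proof. by apply/val_inj; rewrite /= modnDr. Qed.

Lemma cyc_vtx_period i : cyc_vtx (i + n) = cyc_vtx i.
Proof. by rewrite /cyc_vtx modnDr. Qed.

Lemma cyc_segment j i s :
  segment_point (fun l => cyc_vtx (j + l)) i s = edge_point e (cyc (j + i)) s.
Proof. by rewrite /segment_point addnS cyc_vtxS [X in _ *: X]addrC addKr. Qed.

Lemma cyc_curve j : (j < n)%N ->
  closed_curve e = polygonal_curve (fun l => cyc_vtx (j + l)) n.
Proof.
move=> jn; apply/seteqP; split=> [_ [i [s [s01 ->]]]|_ [i [s [im s01 ->]]]].
  (* Adding [n] prevents truncation in the subtraction of [j]. *)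
  exists ((i + n - j) %% n)%N, s; split; first by rewrite ltn_pmod.
    by move: s01; rewrite in_itv.
  rewrite cyc_segment; congr edge_point; apply/val_inj; rewrite /= modnDmr.
  have ni := ltn_ord i.
  by rewrite subnKC ?modnDr ?modn_small // ltnW // ltn_addl.
by exists (cyc (j + i)), s; rewrite cyc_segment in_itv.
Qed.

Lemma cyc_simple j : embedded e -> simple_polygon (fun l => cyc_vtx (j + l)) n.
Proof.
move=> emb i l s t ni nl s01 t01; rewrite !cyc_segment => segE.
have [||/(congr1 val)/= /eqP + _] := emb _ _ s t _ _ segE; rewrite ?in_itv //.
by rewrite eqn_modDl !modn_small // => /eqP.
Qed.

End CyclicIndices.

(* Up to sign, [u] is the diameter vector, tilted slightly so that [0 < u 0 0]: the
   shear [x |-> (dot u x, x_1, x_2)] is then isotopic to the identity. *)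
Lemma monotone_direction (m : nat) (n_gt0 : (0 < m + m)%N)
    (e : @polygon R (m + m)) :
  equilateral e -> m%:R - 1 < diameter e ->
  exists (j : nat) (u : V), [/\ 0 < u 0 0,
    forall i, (i < m)%N -> 0 < dot u (e (cyc n_gt0 (j + i))) &
    forall i, (m <= i < m + m)%N -> dot u (e (cyc n_gt0 (j + i))) < 0].
Proof.
move=> [e1 closed] diam.
have m_gt0 : (0 < m)%N by rewrite -double_gt0 -addnn.
have m1 : 0 <= m%:R - 1 :> R by rewrite subr_ge0 ler1n.
have [j [k jk]] : exists j k : 'I_(m + m), m%:R - 1 < enorm (vtx e k - vtx e j).
  apply: contrapT => nex; move: diam; apply/negP; rewrite -leNgt.
  apply: bigmax_le => // j _; apply: bigmax_le => // k _.
  by rewrite leNgt; apply/negP => jk; apply: nex; exists j, k.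
(* The number of edges on the arc from vertex [j] forward to vertex [k]. *)
pose a := ((k + (m + m) - j) %% (m + m))%N.
have a_le : (a <= m + m)%N by rewrite ltnW // ltn_pmod.
have vj : vtx e j = cyc_vtx e j by rewrite /cyc_vtx modn_small.
have vk : vtx e k = cyc_vtx e (j + a).
  rewrite /cyc_vtx /a modnDmr subnKC; last first.
    by rewrite (leq_trans (ltnW (ltn_ord j))) // leq_addl.
  by rewrite modnDr modn_small.
pose u := vtx e k - vtx e j.
have uE : u = \sum_(l < a) e (cyc n_gt0 (j + l)).
  by rewrite -(cyc_vtxD n_gt0 closed) /u vj vk.
have uNE : - u = \sum_(l < m + m - a) e (cyc n_gt0 (j + a + l)).
  rewrite -(cyc_vtxD n_gt0 closed) -addnA subnKC //.
  by rewrite cyc_vtx_period /u vj vk opprB.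
rewrite -/u in jk; clearbody u.
have enormN : enorm (- u) = enorm u.
  by congr Num.sqrt; rewrite !dotE !mxE; ring.
(* Both arcs span a distance greater than [m - 1] with unit edges, so each has at least [m] of the
   [m + m] edges. *)
have aE : a = m.
  have := @unit_sum_enorm_le _ _ (fun l => e (cyc n_gt0 (j + l))) (fun=> e1 _) uE.
  have := @unit_sum_enorm_le _ _ (fun l => e (cyc n_gt0 (j + a + l)))
    (fun=> e1 _) uNE.
  rewrite enormN => /(lt_le_trans jk) + /(lt_le_trans jk).
  rewrite !ltrBlDr !natr1 !ltr_nat.
  by move: a_le; clear; lia.
rewrite aE addnK in uE uNE.
(* The bound of [dot_unit_sum_ge] for an arc of [m] edges, positive since [enorm u] exceeds
   [m - 1]. *)
pose c := enorm u * (enorm u - (m.-1)%:R).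
have predm : (m.-1)%:R = m%:R - 1 :> R.
  by rewrite -[in RHS](prednK m_gt0) -natr1 addrK.
have c0 : 0 < c.
  rewrite /c predm mulr_gt0 // ?subr_gt0 //.
  exact: le_lt_trans m1 jk.
have up i : (i < m)%N -> c <= dot u (e (cyc n_gt0 (j + i))).
  move=> im; rewrite /c.
  apply: (@dot_unit_sum_ge _ _ (fun l => e (cyc n_gt0 (j + l)))) => //.
    by rewrite prednK.
  by rewrite prednK.
have down i : (i < m)%N -> dot u (e (cyc n_gt0 (j + m + i))) <= - c.
  move=> im; rewrite lerNr.
  have -> : - dot u (e (cyc n_gt0 (j + m + i))) =
      dot (- u) (e (cyc n_gt0 (j + m + i))) by rewrite !dotE !mxE; ring.
  rewrite /c -enormN.
  apply: (@dot_unit_sum_ge _ _ (fun l => e (cyc n_gt0 (j + m + l)))) => //.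
    by rewrite prednK.
  by rewrite prednK.
have [u0|u0] := leP 0 (u 0 0).
  (* The tilt changes the product with a unit edge by at most [c / 2], while the products with [u]
     are at least [c] in absolute value; hence all signs survive. *)
  pose v := u + (c / 2) *: vec3 1 0 0.
  have vE i : dot v (e i) = dot u (e i) + c / 2 * e i 0 0.
    by rewrite !dotE !mxE /=; ring.
  have ce i : - (c / 2) <= c / 2 * e i 0 0 <= c / 2.
    have /andP[? ?] := coord0_unit (e1 i).
    by apply/andP; split; [rewrite -mulrN1 ler_pM2l | rewrite ger_pMr] => //; lra.
  exists j, v; split=> [|i im|i /andP[mi im]].
  - by rewrite !mxE /= mulr1; lra.
  - by rewrite vE; have := up i im; have := ce (cyc n_gt0 (j + i)); lra.
  - rewrite vE; have im' : (i - m < m)%N by rewrite ltn_subLR.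
    have := down _ im'; rewrite -addnA subnKC //.
    by have := ce (cyc n_gt0 (j + i)); lra.
have dotN i : dot (- u) (e i) = - dot u (e i) by rewrite !dotE !mxE; ring.
(* Changing the sign of [u] exchanges the two arcs, so the start moves by [m]. *)
exists (j + m)%N, (- u); split=> [|i im|i /andP[mi im]].
- by rewrite mxE oppr_gt0.
- by rewrite dotN; have := down i im; lra.
- rewrite dotN; have im' : (i - m < m)%N by rewrite ltn_subLR.
  have := up _ im'; rewrite -(cyc_period n_gt0).
  have -> : (j + (i - m) + (m + m) = j + m + i)%N.
    by move: mi; clear; lia.
  by lra.
Qed.

Lemma unknot_wide_polygon (m : nat) (e : @polygon R (m + m)) : (0 < m)%N ->
  equilateral e -> embedded e -> m%:R - 1 < diameter e ->
  unknot (closed_curve e).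
Proof.
move=> m_gt0 eq_e emb diam; have n_gt0 : (0 < m + m)%N by rewrite addn_gt0 m_gt0.
have [_ closed] := eq_e.
have [j [u [u0 up down]]] := monotone_direction n_gt0 eq_e diam.
pose j' := (j %% (m + m))%N.
have cycj i : cyc n_gt0 (j' + i) = cyc n_gt0 (j + i).
  by apply/val_inj; rewrite /= modnDml.
have edgeE i : cyc_vtx e (j' + i.+1) - cyc_vtx e (j' + i) = e (cyc n_gt0 (j + i)).
  by rewrite addnS (cyc_vtxS n_gt0 closed) cycj [LHS]addrC addKr.
have [||||f isof fE] := @straighten_polygon _ (fun l => cyc_vtx e (j' + l)) m u
  m_gt0 u0.
- by rewrite cyc_vtx_period addn0.
- by move=> i im; rewrite edgeE; exact: up.
- by move=> i im; rewrite edgeE; exact: down.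
- exact: (cyc_simple n_gt0 closed).
rewrite /unknot -fE (cyc_curve n_gt0 closed (ltn_pmod j n_gt0)).
exact: isotopic_id_image.
Qed.

End WidePolygons.

(** * Monotonicity of the symplectic volume on arbitrary sets *)

Section Monotonicity.
Local Open Scope ereal_scope.
Context {R : realType}.

(* The measures are applied below to sets that are not known to be measurable. The
   integral of a nonnegative function is a supremum over the simple functions below
   it, hence monotone without any measurability assumption. *)
Lemma le_integral_ge0 d (T : measurableType d)
    (nu : {measure set T -> \bar R}) (f g : T -> \bar R) :
  (forall x, 0 <= f x) -> (forall x, f x <= g x) ->
  \int[nu]_x f x <= \int[nu]_x g x.
Proof.
move=> f0 fg; have g0 x : 0 <= g x := le_trans (f0 x) (fg x).
rewrite !ge0_integralTE //; apply: le_ereal_sup => _ [h /= hf <-].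
by exists h => //= x; exact: le_trans (fg x).
Qed.

(** The product measure integrates the [nu2]-values of the sections against [nu1]. Monotonicity is
    therefore assumed of [nu2] alone; the integral supplies the rest. *)
Lemma le_product_measure d1 d2 (T1 : measurableType d1) (T2 : measurableType d2)
    (nu1 : {measure set T1 -> \bar R})
    (nu2 : {sigma_finite_measure set T2 -> \bar R}) :
  (forall A B, A `<=` B -> nu2 A <= nu2 B) ->
  forall A B, A `<=` B -> (nu1 \x nu2) A <= (nu1 \x nu2) B.
Proof.
move=> mono A B AB; apply: le_integral_ge0 => x /=; first exact: measure_ge0.
exact/mono/le_xsection.
Qed.

Lemma le_lebesgue_tuple m A B : A `<=` B ->
  @lebesgue_tuple R m A <= @lebesgue_tuple R m B.
Proof.
elim: m A B => [|m IH] A B AB.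
  rewrite /= /dirac !indicE lee_fin ler_nat.
  have [tA|//] := boolP ([tuple] \in A).
  by rewrite (mem_set (AB _ (set_mem tA))).
rewrite /= /cons_measure /pushforward.
by apply: (le_product_measure (@lebesgue_measure R) IH); exact: preimage_subset.
Qed.

Lemma le_mu n (A B : set (set (@polygon R n))) : A `<=` B -> mu A <= mu B.
Proof.
move=> AB; apply: (le_product_measure _ (@le_lebesgue_tuple _)).
by move=> x [e [? ? /AB ? ?]]; exists e.
Qed.

Lemma mu_ge0 n (A : set (set (@polygon R n))) : 0 <= mu A.
Proof. exact: integral_ge0. Qed.

End Monotonicity.

(** * Comparison of knotting probabilities *)

Lemma moduli_knotted_sub (R : realType) (n : nat) (r : R) : (4 <= n)%N ->
  ~~ odd n -> n%:R / 2 - 1 < r -> @moduli_knotted R n `<=` moduli_le r.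
Proof.
move=> n4 n_even rn _ [e [eq_e [emb knot]] <-]; exists e => //; split => //.
rewrite leNgt; apply/negP => re; apply: knot.
have nE : n = (n./2 + n./2)%N by rewrite addnn even_halfK.
move: (n./2) nE => m nE; subst n.
apply: unknot_wide_polygon => //; first by move: n4; clear; lia.
apply: lt_trans re; suff -> : m%:R = (m + m)%:R / 2 :> R by [].
by rewrite natrD; field.
Qed.

Theorem mainTheorem2 (R : realType) (n : nat) (hn : (4 <= n)%N)
    (n_even : ~~ odd n) :
  exists2 eps : R, 0 < eps &
    forall r r' : R,
      1 <= r -> (0 < mu (@moduli_le R n r))%E ->
      n%:R / 2 - eps < r -> r <= r' -> r' <= n%:R / 2 ->
      knotting_probability n r' <= knotting_probability n r.
Proof.
(* With [eps = 1], both radii exceed [n / 2 - 1], so both numerators become the volume of all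
   knotted polygons. *)
exists 1 => // r r' _ mu_r rn rr' _; rewrite /knotting_probability.
rewrite (setIidl (moduli_knotted_sub hn n_even rn)).
rewrite (setIidl (moduli_knotted_sub hn n_even (lt_le_trans rn rr'))).
set K := fine (mu (@moduli_knotted R n)).
have K0 : 0 <= K by exact/fine_ge0/mu_ge0.
have mu_le : (mu (@moduli_le R n r) <= mu (@moduli_le R n r'))%E.
  apply: le_mu => _ [e [eq_e er] <-].
  by exists e => //; split => //; exact: le_trans rr'.
have [fin|] := boolP (mu (@moduli_le R n r') < +oo)%E; last first.
  (* [fine] sends an infinite volume to [0], whose inverse is [0] by convention, so the left-hand
     side is [0] and finiteness of [mu] need not be proved. *)
  rewrite -leNgt leye_eq => /eqP ->; rewrite invr0 mulr0.
  by rewrite divr_ge0 // fine_ge0 // mu_ge0.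
have fin' := le_lt_trans mu_le fin.
apply: ler_wpM2l => //; rewrite lef_pV2 ?posrE.
- by apply: fine_le => //; rewrite ge0_fin_numE ?mu_ge0.
- by apply: fine_gt0; rewrite (lt_le_trans mu_r mu_le) fin.
- by apply: fine_gt0; rewrite mu_r fin'.
Qed.
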